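(* Let $\mathcal{P}\subset(\mathbb{R}_{\ge0})^N$ be an integral polytope of dimension $d$ with vertices $\mathbf{v}_i=(v_{i1},\dots,v_{iN})$, $1\le i\le m$. Then there exists a polynomial $L_{\mathcal{P}}(x_1,\dots,x_N)\in\mathbb{Q}(\mathbf{q})[x_1,\dots,x_N]$ such that \[ L_{\mathcal{P}}([n]_{q_1},[n]_{q_2},\dots,[n]_{q_N})=\sigma_{n\mathcal{P}}(\mathbf{q})\quad\text{for all } n\in\mathbb{Z}_{>0}, \] and the total degree of $L_{\mathcal{P}}$ equals $\max\{\sum_{k=1}^N v_{ik}\mid 1\le i\le m\}$.
   Context: Let $q_1,\dots,q_N$ be indeterminates and $\mathbb{Q}(\mathbf{q})=\mathbb{Q}(q_1,\dots,q_N)$ the field of rational functions. For $\mathbf{a}\in\mathbb{Z}^N$, $\mathbf{q}^{\mathbf{a}}=q_1^{a_1}\cdots q_N^{a_N}$. For a polytope $S\subset\mathbb{R}^N$, $\sigma_S(\mathbf{q})=\sum_{\mathbf{a}\in S\cap\mathbb{Z}^N}\mathbf{q}^{\mathbf{a}}$. An integral polytope is a convex polytope with vertices in $\mathbb{Z}^N$; $n\mathcal{P}=\{n\alpha\mid\alpha\in\mathcal{P}\}$. The $q$-integer is $[n]_q=\frac{1-q^n}{1-q}$ for $n\in\mathbb{Z}$. *)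

(* Defs.v *)
From HB Require Import structures.
From mathcomp Require Import all_boot all_order all_algebra.
From mathcomp Require Import boolp classical_sets fsbigop reals.
From mathcomp Require Import mpoly.

Set Implicit Arguments.
Unset Strict Implicit.
Unset Printing Implicit Defensive.

Import Order.TTheory GRing.Theory Num.Theory.

Local Open Scope classical_set_scope.
Local Open Scope ring_scope.

Section Polytopes.
Variables (R : realType) (N : nat).
Implicit Types (A P S : set 'rV[R]_N).

Definition conv_hull A : set 'rV[R]_N :=
  [set x | exists (k : nat) (p : 'I_k -> 'rV[R]_N) (c : 'I_k -> R),
     [/\ forall i, A (p i), forall i, 0 <= c i,
         \sum_(i < k) c i = 1 & x = \sum_(i < k) c i *: p i]].

Definition aff_hull A : set 'rV[R]_N :=
  [set x | exists (k : nat) (p : 'I_k -> 'rV[R]_N) (c : 'I_k -> R),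
     [/\ forall i, A (p i),
         \sum_(i < k) c i = 1 & x = \sum_(i < k) c i *: p i]].

(* The dimension of the affine hull; no d satisfies this when A is empty. *)
Definition has_dim A (d : nat) : Prop :=
  exists (x0 : 'rV[R]_N) (U : {vspace 'rV[R]_N}),
    \dim U = d /\ aff_hull A = [set x | x - x0 \in U].

Definition polytope P : Prop :=
  exists2 s : seq 'rV[R]_N, s != [::] & P = conv_hull [set x | x \in s].

(* The vertices of a polytope are its extreme points. *)
Definition vertex P (v : 'rV[R]_N) : Prop :=
  P v /\ forall (x y : 'rV[R]_N) (t : R), P x -> P y -> 0 < t < 1 ->
    v = t *: x + (1 - t) *: y -> x = v /\ y = v.

Definition int_point (a : 'rV[int]_N) : 'rV[R]_N := map_mx intr a.

Definition integral_polytope P : Prop :=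
  polytope P /\ forall v, vertex P v -> exists a, v = int_point a.

Definition dilate (n : nat) P : set 'rV[R]_N := [set n%:R *: x | x in P].

End Polytopes.

Definition qvar (N : nat) (k : 'I_N) : {fraction {mpoly rat[N]}} :=
  tofrac ('X_k : {mpoly rat[N]}).

Definition qmon (N : nat) (a : 'rV[int]_N) : {fraction {mpoly rat[N]}} :=
  \prod_(k < N) qvar k ^ a ord0 k.

(* The sum over a set is 0 by convention when infinitely many terms are
   nonzero; this does not occur for bounded S. *)
Definition sigma (R : realType) (N : nat) (S : set 'rV[R]_N) :
    {fraction {mpoly rat[N]}} :=
  \sum_(a \in [set a : 'rV[int]_N | S (int_point R a)]) qmon a.

Definition qint (F : fieldType) (n : int) (q : F) : F := (1 - q ^ n) / (1 - q).

(* msize is 1 + the total degree, and 0 on the zero polynomial. *)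
Definition tdegree (N : nat) (F : fieldType) (p : {mpoly F[N]}) : nat :=
  (msize p).-1.

(* Main.v *)
Require Import Defs.
From HB Require Import structures.
From mathcomp Require Import all_boot all_order all_algebra finmap.
From mathcomp Require Import boolp classical_sets fsbigop reals cardinality.
From mathcomp Require Import mpoly.
From mathcomp Require Import ring.

Set Implicit Arguments.
Unset Strict Implicit.
Unset Printing Implicit Defensive.

Import Order.TTheory GRing.Theory Num.Theory.

Local Open Scope classical_set_scope.
Local Open Scope ring_scope.

(** Every point of the cone over [P] has a unique lexicographically greatest
    nonnegative representation in terms of the vertices, and whether a
    representation is greatest depends only on its support.  Hence the lattice
    points of [n P] split according to this support [F], as in a pulling
    triangulation.  For fixed [F], let [f J n] be the sum of [q^x] over the
    lattice points of [n P] with support [F] whose coefficients on [J] are at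
    most 1.  Subtracting the vertex [v_j] from the points whose [j]-th
    coefficient exceeds 1 gives
      [f J n = f (J + j) n + q^{v_j} f J (n - 1)],
    while [f F n = 0] for [n > #|F|].  Solving these recursions yields
    [sigma_{nP} = \sum_i c_i (q^{v_i})^n] for all [n >= 1], and
    [q_k^n = 1 - (1 - q_k) [n]_{q_k}] turns this into a polynomial in the
    [q]-integers of degree at most [M = max |v_i|].  The degree is not smaller:
    after clearing denominators, a polynomial of degree less than [M] in the
    [q]-integers has [q]-degree at most [C + (n - 1)(M - 1)], whereas
    [sigma_{nP}] contains a monomial of degree [n M]. *)

(** * Lexicographically greatest nonnegative representations *)

Section LexOptimal.
Variables (R : realFieldType) (m p : nat) (W : 'M[R]_(m, p)).
Implicit Types (x l u : 'rV[R]_m) (F : {set 'I_m}).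

Definition nonneg x := forall i, 0 <= x ord0 i.

Definition rowsupp x : {set 'I_m} := [set i | x ord0 i != 0]%SET.

(** The first nonzero coordinate is positive, so [lexpos (y - x)] is the strict lexicographic
    order. *)
Definition lexpos x :=
  exists i, 0 < x ord0 i /\ forall j : 'I_m, (j < i)%N -> x ord0 j = 0.

Lemma lexpos0 : ~ lexpos 0.
Proof. by move=> [i []]; rewrite mxE ltxx. Qed.

Lemma lexposD x y : lexpos x -> lexpos y -> lexpos (x + y).
Proof.
move=> [i [xi x0]] [j [yj y0]].
have [ij|ji|/val_inj ij] := ltngtP i j.
- exists i; rewrite mxE (y0 i ij) addr0; split=> // k ki.
  by rewrite mxE x0 // y0 ?addr0 // (ltn_trans ki).
- exists j; rewrite mxE (x0 j ji) add0r; split=> // k kj.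
  by rewrite mxE y0 // x0 ?addr0 // (ltn_trans kj).
- subst j; exists i; rewrite mxE addr_gt0 //; split=> // k ki.
  by rewrite mxE x0 // y0 ?addr0.
Qed.

Lemma lexposZ t x : 0 < t -> lexpos x -> lexpos (t *: x).
Proof.
move=> t0 [i [xi x0]]; exists i; rewrite mxE mulr_gt0 //; split=> // k ki.
by rewrite mxE x0 ?mulr0.
Qed.

Lemma lexpos_total x : x != 0 -> lexpos x \/ lexpos (- x).
Proof.
move=> /eqP xN0.
have /existsP[i0 i0P] : [exists i, x ord0 i != 0].
  apply: contra_notT xN0; rewrite negb_exists => /forallP x0.
  by apply/rowP => i; rewrite mxE; have := x0 i; rewrite negbK => /eqP.
case: (arg_minnP (P := fun i => x ord0 i != 0) (fun i : 'I_m => i : nat) i0P) => i xi imin.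
have xj (j : 'I_m) : (j < i)%N -> x ord0 j = 0.
  by move=> ji; apply/eqP; apply: contraLR ji => /imin; rewrite -leqNgt.
move: xi; rewrite neq_lt => /orP[xi|xi].
  right; exists i; rewrite mxE oppr_gt0; split=> // j ji.
  by rewrite mxE xj ?oppr0.
by left; exists i.
Qed.

(** Linear independence of the rows of [W] indexed by [F]. *)
Definition basic F := forall u, u *m W = 0 -> rowsupp u \subset F -> u = 0.

(* A nonnegative [l] is lexicographically greatest in its fiber iff no kernel
   vector increases it while staying nonnegative for small steps; this only
   constrains the signs outside the support of [l]. *)
Definition standard F :=
  forall u, u *m W = 0 -> lexpos u -> exists2 i, i \notin F & u ord0 i < 0.

Lemma notin_rowsupp x i : i \notin rowsupp x -> x ord0 i = 0.
Proof. by rewrite inE negbK => /eqP. Qed.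

(** For distinct [l1] and [l2], the larger minus the smaller is a lexicographically positive kernel
    vector. Off the support of the smaller it has the coordinates of the larger, which are
    nonnegative, against standardness. *)
Lemma standard_uniq l1 l2 : nonneg l1 -> nonneg l2 ->
  standard (rowsupp l1) -> standard (rowsupp l2) ->
  l1 *m W = l2 *m W -> l1 = l2.
Proof.
move=> l1p l2p s1 s2 eW; apply/eqP; rewrite -subr_eq0; apply/negPn/negP.
have noinc k1 k2 : nonneg k2 -> standard (rowsupp k1) ->
    k1 *m W = k2 *m W -> ~ lexpos (k2 - k1).
  move=> k2p s ek /s[]; first by rewrite mulmxBl ek subrr.
  by move=> i /notin_rowsupp; rewrite !mxE => ->; rewrite subr0 ltNge k2p.
move=> /lexpos_total[]; first exact: noinc.
by rewrite opprB; apply: noinc.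
Qed.

Lemma basic_uniq l1 l2 : rowsupp l1 = rowsupp l2 -> basic (rowsupp l1) ->
  l1 *m W = l2 *m W -> l1 = l2.
Proof.
move=> es b eW; apply/eqP; rewrite -subr_eq0; apply/eqP/b.
  by rewrite mulmxBl eW subrr.
apply/fintype.subsetP => i; rewrite inE; apply: contraR => iN.
by rewrite !mxE !notin_rowsupp -?es ?subrr.
Qed.

(** The ratio test of the simplex method: the step stops when a first coordinate reaches 0. *)
Lemma nonneg_move l u : nonneg l ->
  (forall i, i \notin rowsupp l -> 0 <= u ord0 i) ->
  (exists i, u ord0 i < 0) ->
  exists t, [/\ 0 < t, nonneg (l + t *: u) &
    exists2 i, i \in rowsupp l & (l + t *: u) ord0 i = 0].
Proof.
move=> lp up [i0 ui0].
case: (arg_minP (fun i => l ord0 i / - u ord0 i) (P := fun i => u ord0 i < 0) ui0).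
move=> i ui imin.
have iS : i \in rowsupp l by apply: contraLR ui => /up; rewrite leNgt.
have ui' : 0 < - u ord0 i by rewrite oppr_gt0.
have li : 0 < l ord0 i by rewrite lt_neqAle lp andbT eq_sym; move: iS; rewrite inE.
exists (l ord0 i / - u ord0 i); split; first by rewrite divr_gt0.
- move=> j; rewrite !mxE; have [uj|uj] := ltP (u ord0 j) 0; last first.
    by rewrite addr_ge0 // mulr_ge0 // divr_ge0 // ltW.
  have := imin _ uj; rewrite ler_pdivlMr ?oppr_gt0 // mulrN.
  by rewrite -subr_ge0 opprK.
- by exists i => //; rewrite !mxE invrN mulrN mulNr divfK ?subrr // lt_eqF.
Qed.

Hypothesis pointed : forall u, nonneg u -> u *m W = 0 -> u = 0.

Lemma ker_has_neg u : u *m W = 0 -> u != 0 -> exists i, u ord0 i < 0.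
Proof.
move=> uW u0; apply/not_existsP => uN; move/eqP: u0; apply.
by apply: pointed => // i; rewrite leNgt; apply/negP/uN.
Qed.

(* Carathéodory's reduction, moving along the lexicographically increasing
   direction of a linear relation. *)
Lemma basic_rep l : nonneg l -> exists l', [/\ nonneg l', l' *m W = l *m W,
  basic (rowsupp l') & l' = l \/ lexpos (l' - l)].
Proof.
have [k] := ubnP #|rowsupp l|; elim: k l => // k IH l; rewrite ltnS => lk lp.
have [b|] := pselect (basic (rowsupp l)); first by exists l; split=> //; left.
move=> /existsNP[u0 /not_implyP[u0W /not_implyP[u0S /eqP u00]]].
have [u [uW uS u00' upos]] : exists u,
    [/\ u *m W = 0, rowsupp u \subset rowsupp l, u != 0 & lexpos u].
  case: (lexpos_total u00) => h; first by exists u0.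
  exists (- u0); split; rewrite ?mulNmx ?u0W ?oppr0 ?oppr_eq0 //.
  apply: fintype.subset_trans u0S; apply/fintype.subsetP => i.
  by rewrite !inE mxE oppr_eq0.
have uoff i : i \notin rowsupp l -> u ord0 i = 0.
  by move=> iN; apply: notin_rowsupp; apply: contra iN; apply: (fintype.subsetP uS).
have [] := @nonneg_move l u lp _ (ker_has_neg uW u00').
  by move=> i /uoff ->.
move=> t [t0 tp [i iS i0]].
have lW : (l + t *: u) *m W = l *m W by rewrite mulmxDl -scalemxAl uW scaler0 addr0.
have sub : rowsupp (l + t *: u) \proper rowsupp l.
  apply/properP; split; last by exists i => //; rewrite inE i0 eqxx.
  apply/fintype.subsetP => j; apply: contraLR => jN.
  by rewrite inE !mxE uoff // notin_rowsupp // mulr0 addr0 eqxx.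
have [l' [l'p l'W l'b l'l]] := IH _ (leq_trans (proper_card sub) lk) tp.
exists l'; split=> //; first by rewrite l'W.
right; have tu : lexpos (t *: u) by apply: lexposZ.
case: l'l => [->|h]; first by rewrite addrC addKr.
have -> : l' - l = (l' - (l + t *: u)) + t *: u by rewrite opprD addrA subrK.
exact: lexposD.
Qed.

(** A step along a kernel vector violating standardness, followed by reduction to a basic
    representation, increases lexicographically. This can happen only finitely often, as a basic
    representation is determined within its fiber by its support. *)
Lemma standard_rep l : nonneg l ->
  exists l', [/\ nonneg l', l' *m W = l *m W & standard (rowsupp l')].
Proof.
move=> /basic_rep[l0 [l0p <- l0b _]] {l}.
(* Termination measure: the supports of basic representations greater than [l] in its fiber. *)
pose above l := [set F | `[< exists l', [/\ nonneg l', l' *m W = l *m W,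
  basic (rowsupp l'), rowsupp l' = F & lexpos (l' - l)] >]]%SET.
have [k] := ubnP #|above l0|; elim: k l0 l0p l0b => // k IH l lp lb.
rewrite ltnS => lk.
have [s|] := pselect (standard (rowsupp l)); first by exists l.
move=> /existsNP[u /not_implyP[uW /not_implyP[upos noneg]]].
have u0 : u != 0 by apply/eqP => u0; apply: lexpos0; rewrite -u0.
have [] := @nonneg_move l u lp _ (ker_has_neg uW u0).
  by move=> i iN; rewrite leNgt; apply/negP => ui; apply: noneg; exists i.
move=> t [t0 tp _].
have lW : (l + t *: u) *m W = l *m W by rewrite mulmxDl -scalemxAl uW scaler0 addr0.
have [l2 [l2p l2W l2b l2l]] := basic_rep tp.
have l2pos : lexpos (l2 - l).
  have tu : lexpos (t *: u) by apply: lexposZ.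
  case: l2l => [->|h]; first by rewrite addrC addKr.
  have -> : l2 - l = (l2 - (l + t *: u)) + t *: u by rewrite opprD addrA subrK.
  exact: lexposD.
rewrite lW in l2W.
have sub : above l2 \proper above l.
  apply/properP; split.
    apply/fintype.subsetP => F; rewrite !finset.in_set => /asboolP[l' [h1 h2 h3 h4 h5]].
    apply/asboolP; exists l'; split=> //; first by rewrite h2.
    have -> : l' - l = (l' - l2) + (l2 - l) by rewrite addrA subrK.
    exact: lexposD.
  exists (rowsupp l2); first by rewrite finset.in_set; apply/asboolP; exists l2.
  rewrite finset.in_set; apply/asboolP => -[l' [h1 h2 h3 h4]].
  by rewrite (basic_uniq h4 h3 h2) subrr => /lexpos0.
have [l' [h1 h2 h3]] := IH l2 l2p l2b (leq_trans (proper_card sub) lk).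
by exists l'; split=> //; rewrite h2.
Qed.

End LexOptimal.

(** Induction on the size of [F :\: J]: once [f (j |: J)] is an exponential sum, [f J] satisfies a
    first-order linear recursion with ratio [z j], and distinctness of the ratios excludes
    resonance. *)
Lemma exp_sum_recursion (K : fieldType) (I : finType) (z : I -> K)
    (F : {set I}) (f : {set I} -> nat -> K) :
  {in F &, injective z} -> (forall i, z i != 0) ->
  (forall n, (#|F| < n)%N -> f F n = 0) ->
  (forall (J : {set I}) j n, J \subset F -> j \in F -> j \notin J ->
     f J n.+1 = f (j |: J)%SET n.+1 + z j * f J n) ->
  forall J : {set I}, J \subset F -> exists c : I -> K,
    forall n, (#|J| < n)%N -> f J n = \sum_(i in F :\: J) c i * z i ^+ n.
Proof.
move=> zI z0 fF fJ J.
have [k] := ubnP #|F :\: J|; elim: k J => // k IH J; rewrite ltnS => Jk JF.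
have [/eqP FJ0|/set0Pn[j]] := boolP (F :\: J == finset.set0).
  exists (fun=> 0) => n nJ; rewrite FJ0 big_set0.
  have -> : J = F by apply/eqP; rewrite finset.eqEsubset JF -finset.setD_eq0 FJ0 eqxx.
  rewrite fF //; apply: leq_trans nJ; rewrite ltnS; apply: subset_leq_card.
  by rewrite -finset.setD_eq0 FJ0.
rewrite finset.in_setD => /andP[jJ jF].
have jFJ : j \in F :\: J by rewrite finset.in_setD jJ.
have eFJ : F :\: (j |: J) = (F :\: J) :\ j.
  by apply/finset.setP => i; rewrite !inE negb_or andbA.
have [] := IH (j |: J)%SET.
- by move: Jk; rewrite eFJ (cardsD1 j (F :\: J)) jFJ.
- by rewrite finset.subUset finset.sub1set jF.
move=> c cP.
have zij i : i \in (F :\: J) :\ j -> z i - z j != 0.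
  rewrite !inE => /andP[ij /andP[_ iF]]; rewrite subr_eq0.
  by apply: contra ij => /eqP /(zI _ _ iF jF) ->.
(* Coefficients of a particular solution: d_i (z_i - z_j) = c_i z_i. *)
pose d i := c i * z i / (z i - z j).
(* The remainder solves the homogeneous recursion, hence is geometric from [#|J|.+1] on. *)
pose g n := f J n - \sum_(i in (F :\: J) :\ j) d i * z i ^+ n.
have gS n : (#|J| < n)%N -> g n.+1 = z j * g n.
  move=> nJ; rewrite /g (fJ J j) // cP; last by rewrite cardsU1 jJ.
  rewrite eFJ mulrBr addrAC [RHS]addrC; congr (_ + _).
  rewrite mulr_sumr -sumrB -sumrN; apply: eq_bigr => i /zij zz.
  rewrite /d exprS; field; exact: zz.
have gn n : (#|J| < n)%N -> g n = g #|J|.+1 / z j ^+ #|J|.+1 * z j ^+ n.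
  elim: n => // n IHn; rewrite ltnS leq_eqVlt => /orP[/eqP <-|nJ].
    by rewrite divfK // expf_neq0.
  by rewrite gS // IHn // [z j ^+ n.+1]exprS mulrCA.
exists (fun i => if i == j then g #|J|.+1 / z j ^+ #|J|.+1 else d i) => n nJ.
rewrite (finset.big_setD1 j) //= eqxx -gn // /g.
under [X in _ = _ + X]eq_bigr => i.
  rewrite !inE => /andP[/negPf -> _]; over.
by rewrite subrK.
Qed.

(** * Polytopes as convex hulls of their vertices *)

Section Hull.
Variables (R : realType) (N : nat).
Implicit Types (s : seq 'rV[R]_N) (P : set 'rV[R]_N) (x y : 'rV[R]_N).

(** Weights are attached to the points themselves, not to families of arbitrary length, so that
    single points can be removed from the list. *)
Definition seq_hull s : set 'rV[R]_N :=
  [set x | exists c : 'rV[R]_N -> R, [/\ forall y, 0 <= c y,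
     \sum_(y <- s) c y = 1 & x = \sum_(y <- s) c y *: y]].

Lemma conv_hull_seq s : uniq s -> conv_hull [set x | x \in s] = seq_hull s.
Proof.
move=> us; apply/seteqP; split=> x.
  move=> [k [p [c [pA c0 c1 ->]]]].
  have part (V : zmodType) (g : 'I_k -> V) :
      \sum_(i < k) g i = \sum_(y <- s) \sum_(i < k | p i == y) g i.
    rewrite (exchange_big_dep predT) //=; apply: eq_bigr => i _.
    under eq_bigl do rewrite eq_sym; rewrite -big_filter filter_pred1_uniq //.
      by rewrite big_seq1.
    exact: pA.
  exists (fun y => \sum_(i < k | p i == y) c i); split.
  - by move=> y; apply: sumr_ge0.
  - by rewrite -part.
  - rewrite part; apply: eq_bigr => y _; rewrite scaler_suml.
    by apply: eq_bigr => i /eqP ->.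
move=> [c [c0 c1 xE]]; exists (size s), (fun i => s`_i), (fun i => c s`_i).
split=> //.
- by move=> i /=; rewrite mem_nth.
- by rewrite -c1 (big_nth 0) big_mkord.
- by rewrite xE (big_nth 0) big_mkord.
Qed.

Lemma seq_hull_rem s x : uniq s -> x \in s -> ~ vertex (seq_hull s) x ->
  seq_hull s = seq_hull (rem x s).
Proof.
move=> us xs nv.
have split1 (V : zmodType) (g : 'rV[R]_N -> V) :
  \sum_(y <- s) g y = g x + \sum_(y <- rem x s) g y by rewrite (big_rem x).
have xNr : x \notin rem x s by rewrite mem_rem_uniq // inE eqxx.
have neq z : z \in rem x s -> (z == x) = false.
  by move=> zr; apply/eqP => zx; rewrite zx (negPf xNr) in zr.
have sx : seq_hull s x.
  exists (fun y => (y == x)%:R); split=> [y||]; first by rewrite ler0n.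
    rewrite split1 eqxx big_seq big1 ?addr0 // => y yr.
    by rewrite neq.
  rewrite split1 eqxx scale1r big_seq big1 ?addr0 // => y yr.
  by rewrite neq // scale0r.
(* If [x] were no convex combination of the other points, it would be extreme: a segment through [x]
   merges the weights of its endpoints into weights [e] for [x]. *)
have [e [e0 e1 xE]] : exists e : 'rV[R]_N -> R, [/\ forall y, 0 <= e y,
    \sum_(y <- rem x s) e y = 1 & x = \sum_(y <- rem x s) e y *: y].
  apply: contra_notP nv => noe; split=> // x1 x2 t [a [a0 a1 x1E]] [b [b0 b1 x2E]].
  move=> /andP[t0 t1] xE.
  pose e y := t * a y + (1 - t) * b y.
  have e0 y : 0 <= e y by rewrite addr_ge0 // mulr_ge0 // ?subr_ge0 ltW.
  have esum : \sum_(y <- s) e y = 1.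
    by rewrite big_split /= -!mulr_sumr a1 b1 !mulr1 addrC subrK.
  have exE : x = \sum_(y <- s) e y *: y.
    rewrite {1}xE x1E x2E !scaler_sumr -big_split /=; apply: eq_bigr => y _.
    by rewrite [in RHS]scalerDl !scalerA.
  (* If all the weight sits on [x], both endpoints equal [x]. *)
  have [ex1|exN1] := eqVneq (e x) 1.
    have er0 : \sum_(y <- rem x s) e y = 0.
      by apply: (addrI (e x)); rewrite -split1 esum addr0.
    have ey0 y : y \in rem x s -> e y = 0.
      move=> yr; apply/eqP; move/eqP: er0.
      by rewrite psumr_eq0 // => /allP /(_ _ yr).
    have ab0 y : y \in rem x s -> a y = 0 /\ b y = 0.
      move=> /ey0; rewrite /e => ey.
      have ta : 0 <= t * a y by rewrite mulr_ge0 // ltW.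
      have tb : 0 <= (1 - t) * b y by rewrite mulr_ge0 // subr_ge0 ltW.
      have := eqxx (t * a y + (1 - t) * b y); rewrite {2}ey paddr_eq0 //.
      rewrite !mulf_eq0 !(gt_eqF t0) subr_eq0 (gt_eqF t1) /=.
      by move=> /andP[/eqP -> /eqP ->].
    have conc h z : (forall y, y \in rem x s -> h y = 0) ->
        \sum_(y <- s) h y = 1 -> z = \sum_(y <- s) h y *: y -> z = x.
      move=> h0; rewrite !split1 !big_seq big1 // addr0 => -> ->.
      by rewrite big1 ?addr0 ?scale1r // => y /h0 ->; rewrite scale0r.
    split; [apply: (conc a)|apply: (conc b)] => // y /ab0[] //.
  have er : \sum_(y <- rem x s) e y = 1 - e x by rewrite -esum split1 addrC addKr.
  have ex1 : 0 < 1 - e x.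
    rewrite lt_neqAle -er sumr_ge0 // andbT er eq_sym subr_eq0 eq_sym.
    exact: exN1.
  (* Otherwise the relation can be solved for [x] in terms of the other points. *)
  exfalso; apply: noe; exists (fun y => e y / (1 - e x)); split.
  - by move=> y; rewrite divr_ge0 // ltW.
  - by rewrite -mulr_suml er divff // gt_eqF.
  - have -> : \sum_(y <- rem x s) (e y / (1 - e x)) *: y =
        (1 - e x)^-1 *: \sum_(y <- rem x s) e y *: y.
      by rewrite scaler_sumr; apply: eq_bigr => y _; rewrite scalerA mulrC.
    have -> : \sum_(y <- rem x s) e y *: y = (1 - e x) *: x.
      rewrite scalerBl scale1r; apply/eqP; rewrite eq_sym subr_eq addrC.
      by rewrite -(split1 _ (fun y => e y *: y)) -exE.
    by rewrite scalerA mulVf ?scale1r // gt_eqF.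
apply/seteqP; split=> y [c [c0 c1 yE]].
  (* The weight of [x] is spread over the other points according to [e]. *)
  exists (fun z => c z + c x * e z); split=> [z||].
  - by rewrite addr_ge0 // mulr_ge0.
  - by rewrite big_split /= -mulr_sumr e1 mulr1 -c1 split1 addrC.
  - rewrite yE split1 {2}xE scaler_sumr addrC -big_split /=.
    by apply: eq_bigr => z _; rewrite scalerDl scalerA.
exists (fun z => if z == x then 0 else c z); split=> [z||].
- by case: ifP.
- rewrite split1 eqxx add0r -c1 !big_seq.
  by apply: eq_bigr => z /neq ->.
- rewrite split1 eqxx scale0r add0r yE !big_seq.
  by apply: eq_bigr => z /neq ->.
Qed.

(** Points that are not vertices are discarded one at a time, without changing the hull. *)
Lemma polytope_seq_hull P : polytope P -> exists s,
  [/\ uniq s, P = seq_hull s & forall x, x \in s -> vertex P x].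
Proof.
move=> [s0 _ ->].
have -> : [set x | x \in s0] = [set x | x \in undup s0].
  by apply/seteqP; split=> x /=; rewrite mem_undup.
rewrite conv_hull_seq ?undup_uniq //.
have [k] := ubnP (size (undup s0)); move: (undup s0) (undup_uniq s0) => {s0}.
elim: k => // k IH s us; rewrite ltnS => sk.
have [h|] := pselect (forall x, x \in s -> vertex (seq_hull s) x).
  by exists s.
move=> /existsNP[x /not_implyP[xs nv]].
rewrite (seq_hull_rem us xs nv); apply: IH; first exact: rem_uniq.
rewrite size_rem //; apply: leq_trans sk; rewrite prednK //.
by move: xs; case: (s).
Qed.

Lemma polytope_vertexP m (v : 'I_m -> 'rV[R]_N) P x : polytope P ->
    injective v -> (forall x, vertex P x <-> exists i, x = v i) ->
  P x <-> exists l : 'rV[R]_m,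
    [/\ nonneg l, \sum_i l ord0 i = 1 & x = \sum_i l ord0 i *: v i].
Proof.
move=> /polytope_seq_hull[s [us PE sv]] vI vP; split.
  rewrite {1}PE => -[c [c0 c1 xE]].
  (* The list [s] is only known to consist of vertices, so any [v i] outside it gets weight 0. *)
  have part (V : zmodType) (g : 'rV[R]_N -> V) :
      \sum_(y <- s) g y = \sum_i if v i \in s then g (v i) else 0.
    rewrite -big_mkcond /= -[in RHS]big_filter -(big_map v xpredT g) /=.
    apply: perm_big; apply: uniq_perm => //.
      by rewrite map_inj_uniq // filter_uniq // index_enum_uniq.
    move=> y; apply/idP/mapP => [ys|[i]]; last by rewrite mem_filter => /andP[? _] ->.
    have [i yE] := (vP y).1 (sv y ys).
    by exists i => //; rewrite mem_filter -yE ys mem_index_enum.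
  exists (\row_i if v i \in s then c (v i) else 0); split.
  - by move=> i; rewrite mxE; case: ifP.
  - by rewrite -c1 part; apply: eq_bigr => i _; rewrite mxE.
  - rewrite xE part; apply: eq_bigr => i _; rewrite mxE; case: ifP => //.
    by rewrite scale0r.
move=> [l [l0 l1 xE]].
have /boolp.choice[a aP] i : exists c : 'rV[R]_N -> R, [/\ forall y, 0 <= c y,
    \sum_(y <- s) c y = 1 & v i = \sum_(y <- s) c y *: y].
  have : vertex P (v i) by apply/vP; exists i.
  by case; rewrite PE.
rewrite PE; exists (fun y => \sum_i l ord0 i * a i y); split.
- by move=> y; apply: sumr_ge0 => i _; rewrite mulr_ge0 //; case: (aP i).
- rewrite exchange_big /= -l1; apply: eq_bigr => i _.
  by rewrite -mulr_sumr; case: (aP i) => _ -> _; rewrite mulr1.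
- under [RHS]eq_bigr do rewrite scaler_suml.
  rewrite exchange_big /= xE; apply: eq_bigr => i _.
  case: (aP i) => _ _ {1}->; rewrite scaler_sumr.
  by apply: eq_bigr => y _; rewrite scalerA.
Qed.

End Hull.

(** * Decomposition of the lattice points of the dilates *)

Section LatticePoints.
Variables (R : realType) (N m : nat) (u : 'I_m -> 'X_{1..N}).
Implicit Types (l : 'rV[R]_m) (F J : {set 'I_m}) (x : 'rV[int]_N).

Definition nvec (e : 'X_{1..N}) : 'rV[int]_N := \row_k (e k)%:Z.

Lemma qvar_neq0 (k : 'I_N) : qvar k != 0.
Proof. by rewrite tofrac_eq0 -msize_poly_eq0 msizeX. Qed.

Lemma qmonD (x y : 'rV[int]_N) : qmon (x + y) = qmon x * qmon y.
Proof.
rewrite /qmon -big_split /=; apply: eq_bigr => k _.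
by rewrite mxE expfzDr ?qvar_neq0.
Qed.

Lemma qmon_nvec (e : 'X_{1..N}) : qmon (nvec e) = tofrac 'X_[e].
Proof.
rewrite mpolyXE_id rmorph_prod; apply: eq_bigr => k _ /=.
by rewrite mxE rmorphXn.
Qed.

Lemma mpolyX_neq0 (e : 'X_{1..N}) : 'X_[e] != 0 :> {mpoly rat[N]}.
Proof. by rewrite -msize_poly_eq0 msizeX. Qed.

Lemma qmon_nvec_neq0 (e : 'X_{1..N}) : qmon (nvec e) != 0.
Proof. by rewrite qmon_nvec tofrac_eq0 mpolyX_neq0. Qed.

(** Supplies the distinct ratios required by [exp_sum_recursion]. *)
Lemma qmon_nvec_inj : injective (fun e => qmon (nvec e)).
Proof.
move=> e f; rewrite !qmon_nvec => /eqP; rewrite tofrac_eq => /eqP.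
move=> /(congr1 (mcoeff f)); rewrite !mcoeffX eqxx.
by case: eqVneq => // _ /eqP; rewrite eq_sym oner_eq0.
Qed.

Definition vpoint i : 'rV[R]_N := int_point R (nvec (u i)).

Definition combines l n x := [/\ nonneg l, \sum_i l ord0 i = n%:R :> R &
  int_point R x = \sum_i l ord0 i *: vpoint i].

Definition lattice_points n : set 'rV[int]_N :=
  [set x | exists l, combines l n x].

(** Generators of the cone over the polytope: the column of ones records the total weight, so a
    fiber fixes both the point and the dilation factor. *)
Definition homogenization : 'M[R]_(m, N + 1) :=
  row_mx (\matrix_i vpoint i) (const_mx 1).

Lemma mul_homogenization l : l *m homogenization =
  row_mx (\sum_i l ord0 i *: vpoint i) (\sum_i l ord0 i)%:M.
Proof.
rewrite mul_mx_row; congr row_mx.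
  by rewrite mulmx_sum_row; apply: eq_bigr => i _; rewrite rowK.
apply/rowP => k; rewrite !mxE ord1 eqxx mulr1n; apply: eq_bigr => i _.
by rewrite mxE mulr1.
Qed.

Lemma combinesW l1 n1 x1 l2 n2 x2 : combines l1 n1 x1 -> combines l2 n2 x2 ->
  n1 = n2 -> x1 = x2 -> l1 *m homogenization = l2 *m homogenization.
Proof.
move=> [_ s1 e1] [_ s2 e2] en ex; rewrite !mul_homogenization.
by rewrite s1 s2 -e1 -e2 en ex.
Qed.

Lemma homogenization_pointed l :
  nonneg l -> l *m homogenization = 0 -> l = 0.
Proof.
move=> l0; rewrite mul_homogenization -row_mx0 => /eq_row_mx[_ /rowP /(_ ord0)].
rewrite !mxE eqxx mulr1n => /eqP; rewrite psumr_eq0 // => /allP ls.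
by apply/rowP => i; rewrite mxE; apply/eqP/(implyP (ls i _)); rewrite ?mem_index_enum.
Qed.

Definition standard_face F := standard homogenization F.

(* For a standard face [F], the representation witnessing membership is the
   lexicographically greatest one, hence unique. *)
Definition cell F J n : set 'rV[int]_N :=
  [set x | exists l, [/\ combines l n x, rowsupp l = F &
                         forall j, j \in J -> l ord0 j <= 1]].

Lemma cell_sub F J n : cell F J n `<=` lattice_points n.
Proof. by move=> x [l [? _ _]]; exists l. Qed.

Lemma lattice_points_cell n x : lattice_points n x ->
  exists2 F, standard_face F & cell F finset.set0 n x.
Proof.
move=> [l [l0 l1 xE]].
have [l' [l'0 l'W s]] := standard_rep homogenization_pointed l0.
exists (rowsupp l') => //; exists l'; split=> // [|j]; last by rewrite inE.
move: l'W; rewrite !mul_homogenization => /eq_row_mx[eV /rowP /(_ ord0)].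
by rewrite !mxE eqxx !mulr1n => eS; split=> //; rewrite ?eS ?eV.
Qed.

Lemma cell_disjoint F F' J J' n x : standard_face F -> standard_face F' ->
  cell F J n x -> cell F' J' n x -> F = F'.
Proof.
move=> sF sF' [l [lx lF _]] [l' [l'x l'F _]].
rewrite -lF -l'F; congr rowsupp; apply: (@standard_uniq _ _ _ homogenization).
- by case: lx.
- by case: l'x.
- by rewrite lF.
- by rewrite l'F.
- exact: combinesW lx l'x _ _.
Qed.

(** A crude bound, enough for finiteness; nonnegativity makes lattice points exponents of
    monomials. *)
Lemma lattice_points_bound n x k : lattice_points n x ->
  0 <= x ord0 k <= (n * \sum_i mdeg (u i))%N%:Z.
Proof.
move=> [l [l0 l1 /rowP /(_ k)]]; rewrite mxE summxE => xk.
have lk i : (l ord0 i *: vpoint i) ord0 k = l ord0 i * (u i k)%:R.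
  by rewrite !mxE -pmulrn.
apply/andP; split; rewrite -(ler_int R) xk.
  by apply: sumr_ge0 => i _; rewrite lk mulr_ge0.
rewrite -pmulrn natrM -l1 mulr_suml; apply: ler_sum => i _.
rewrite lk ler_wpM2l // ler_nat (bigD1 i) //= mdegE (bigD1 k) //=.
by rewrite -addnA leq_addr.
Qed.

Lemma finite_lattice_points n : finite_set (lattice_points n).
Proof.
pose B := (n * \sum_i mdeg (u i))%N.
apply: (@sub_finite_set _ _
  [set (\row_k (y ord0 k : nat)%:Z : 'rV[int]_N) | y in [set: 'rV['I_B.+1]_N]]).
  move=> x xn; exists (\row_k inord `|x ord0 k|%N) => //.
  apply/rowP => k; have /andP[x0 xB] := lattice_points_bound k xn.
  by rewrite !mxE inordK ?gez0_abs // ltnS -lez_nat gez0_abs.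
exact/finite_image/finite_finset.
Qed.

Lemma finite_cell F J n : finite_set (cell F J n).
Proof. exact: sub_finite_set (@cell_sub F J n) (finite_lattice_points n). Qed.

Lemma deltaE (i j : 'I_m) : (delta_mx ord0 j : 'rV[R]_m) ord0 i = (i == j)%:R.
Proof. by rewrite mxE eqxx. Qed.

Lemma combines_delta j : combines (delta_mx ord0 j) 1 (nvec (u j)).
Proof.
split=> [i||]; first by rewrite deltaE.
  rewrite (bigD1 j) //= deltaE eqxx big1 ?addr0 // => i /negPf ij.
  by rewrite deltaE ij.
rewrite (bigD1 j) //= deltaE eqxx scale1r big1 ?addr0 // => i /negPf ij.
by rewrite deltaE ij scale0r.
Qed.

Lemma combinesD l1 n1 x1 l2 n2 x2 : combines l1 n1 x1 -> combines l2 n2 x2 ->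
  combines (l1 + l2) (n1 + n2) (x1 + x2).
Proof.
move=> [p1 s1 e1] [p2 s2 e2]; split.
- by move=> i; rewrite mxE addr_ge0.
- by rewrite natrD -s1 -s2 -big_split; apply: eq_bigr => i _; rewrite mxE.
- rewrite /int_point map_mxD [X in X + _]e1 [X in _ + X]e2 -big_split.
  by apply: eq_bigr => i _; rewrite mxE scalerDl.
Qed.

Lemma combinesB l1 n1 x1 l2 n2 x2 : (n2 <= n1)%N -> nonneg (l1 - l2) ->
  combines l1 n1 x1 -> combines l2 n2 x2 ->
  combines (l1 - l2) (n1 - n2) (x1 - x2).
Proof.
move=> nn p [p1 s1 e1] [p2 s2 e2]; split=> //.
- by rewrite natrB // -s1 -s2 -sumrB; apply: eq_bigr => i _; rewrite !mxE.
- rewrite /int_point map_mxB [X in X - _]e1 [X in _ - X]e2 -sumrB.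
  by apply: eq_bigr => i _; rewrite !mxE scalerBl.
Qed.

Lemma rowsupp_delta j l : nonneg l -> j \in rowsupp l ->
  rowsupp (delta_mx ord0 j + l) = rowsupp l.
Proof.
move=> l0 jl; apply/finset.setP => i; rewrite !inE mxE deltaE.
case: (eqVneq i j) => [->|_]; last by rewrite add0r.
rewrite gt_eqF ?ltr_pwDl //; apply/esym.
by move: jl; rewrite inE.
Qed.

Lemma cell_shift F J j n y : j \in F -> j \notin J -> cell F J n y ->
  cell F J n.+1 (nvec (u j) + y).
Proof.
move=> jF jJ [l [lx lF lJ]]; exists (delta_mx ord0 j + l); split.
- exact: combinesD (combines_delta j) lx.
- by have [l0 _ _] := lx; rewrite rowsupp_delta ?lF.
- move=> i iJ; rewrite mxE deltaE; case: (eqVneq i j) => [ij|_].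
    by rewrite ij (negPf jJ) in iJ.
  by rewrite add0r lJ.
Qed.

Lemma cellS F J j n : j \in F -> j \notin J ->
  cell F J n.+1 = cell F (j |: J)%SET n.+1 `|`
                  [set nvec (u j) + y | y in cell F J n].
Proof.
move=> jF jJ; apply/seteqP; split=> x; last first.
  move=> [[l [lx lF lJ]]|[y yc <-]]; last exact: cell_shift.
  by exists l; split=> // i iJ; apply: lJ; rewrite !inE iJ orbT.
move=> [l [lx lF lJ]]; have [lj|lj] := leP (l ord0 j) 1.
  left; exists l; split=> // i; rewrite !inE => /orP[/eqP -> //|].
  exact: lJ.
(* The strict inequality keeps the [j]-th coefficient positive after the subtraction, so the support
   stays [F]. *)
right; exists (x - nvec (u j)); last by rewrite addrC subrK.
have [l0 _ _] := lx.
exists (l - delta_mx ord0 j); split.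
- have -> : n = (n.+1 - 1)%N by rewrite subn1.
  apply: combinesB => //; last exact: combines_delta.
  move=> i; rewrite mxE mxE deltaE; case: (eqVneq i j) => [->|_].
    by rewrite subr_ge0 ltW.
  by rewrite subr0.
- rewrite -lF; apply/finset.setP => i; rewrite !inE mxE mxE deltaE.
  case: (eqVneq i j) => [->|_]; last by rewrite subr0.
  by rewrite subr_eq0 !gt_eqF // (lt_trans _ lj).
- move=> i iJ; rewrite mxE mxE deltaE; case: (eqVneq i j) => [ij|_].
    by rewrite ij (negPf jJ) in iJ.
  by rewrite subr0 lJ.
Qed.

(** A common point would have a single standard representation, whose [j]-th coefficient is both at
    most 1 and 1 plus a positive number. *)
Lemma cellS_disjoint F J j n : standard_face F -> j \in F ->
  cell F (j |: J)%SET n.+1 `&` [set nvec (u j) + y | y in cell F J n]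
    `<=` set0.
Proof.
move=> sF jF x [[l [lx lF lJ]] [y [k [kx kF _]] xE]].
have [k0 _ _] := kx; have [l0 _ _] := lx.
have kdx := combinesD (combines_delta j) kx; have [kd0 _ _] := kdx.
have lk : l = delta_mx ord0 j + k.
  apply: (@standard_uniq _ _ _ homogenization) => //.
  - by rewrite lF.
  - by rewrite rowsupp_delta ?kF.
  - exact: combinesW lx kdx _ _.
have := lJ j; rewrite lk !inE eqxx mxE deltaE eqxx => /(_ isT).
by rewrite gerDl leNgt lt_neqAle k0 andbT eq_sym; move: jF; rewrite -kF inE => ->.
Qed.

(** Coefficients at most 1 on [F] and zero elsewhere sum to at most [#|F|]. *)
Lemma cell_full F n : (#|F| < n)%N -> cell F F n = set0.
Proof.
move=> Fn; rewrite -subset0 => x [l [[l0 l1 _] lF lJ]].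
move: Fn; apply/negP; rewrite -leqNgt -(ler_nat R) -l1.
rewrite (bigID (mem F)) /= [X in _ + X]big1 ?addr0; last first.
  by move=> i; rewrite -lF => /notin_rowsupp.
rewrite -sum1_card natr_sum; apply: ler_sum => i; exact: lJ.
Qed.

Definition vmon i := qmon (nvec (u i)).

Lemma cell_sum_recursion F J j n : standard_face F -> j \in F -> j \notin J ->
  \sum_(x \in cell F J n.+1) qmon x =
  \sum_(x \in cell F (j |: J)%SET n.+1) qmon x +
    vmon j * \sum_(x \in cell F J n) qmon x.
Proof.
move=> sF jF jJ; rewrite (cellS n jF jJ) fsbigU0 /=.
- congr (_ + _); rewrite mulr_fsumr fsbig_image /=.
    by apply: eq_fsbigr => x _; rewrite qmonD.
  by move=> x y _ _; apply: addrI.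
- exact: finite_cell.
- exact/finite_image/finite_cell.
- exact: cellS_disjoint.
Qed.

Hypothesis u_inj : injective u.

Lemma cell_sum F : standard_face F -> exists c : 'I_m -> {fraction {mpoly rat[N]}},
  forall n, (0 < n)%N ->
    \sum_(x \in cell F finset.set0 n) qmon x = \sum_(i in F) c i * vmon i ^+ n.
Proof.
move=> sF.
have [] := @exp_sum_recursion _ _ vmon F
  (fun J n => \sum_(x \in cell F J n) qmon x) _ _ _ _ finset.set0.
- by move=> i j _ _ /qmon_nvec_inj /u_inj.
- by move=> i; apply: qmon_nvec_neq0.
- by move=> n Fn; rewrite cell_full // fsbig_set0.
- by move=> J j n _; apply: cell_sum_recursion.
- exact: finset.sub0set.
(* For empty [J] the threshold [#|J|] is 0, so the formula holds from n = 1 on. *)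
- by move=> c cP; exists c => n n0; rewrite cP ?cards0 // finset.setD0.
Qed.

Lemma lattice_points_partition n :
  \sum_(x \in lattice_points n) qmon x =
  \sum_(F : {set 'I_m} | `[< standard_face F >])
    \sum_(x \in cell F finset.set0 n) qmon x.
Proof.
(* All cells are summed over one finite index set, which allows exchanging the sums. *)
have cellE F : \sum_(x \in cell F finset.set0 n) qmon x =
    \sum_(x <- fset_set (lattice_points n) | x \in cell F finset.set0 n) qmon x.
  rewrite [RHS]bigfs ?set_mem_set // => x.
  rewrite inE => /cell_sub xn; rewrite in_fset_set; last exact: finite_lattice_points.
  by move=> /negP[]; rewrite inE.
under [RHS]eq_bigr do rewrite cellE.
rewrite (exchange_big_dep predT) //= fsbig_finite; last exact: finite_lattice_points.
apply: eq_big_seq => x; rewrite in_fset_set; last exact: finite_lattice_points.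
rewrite inE => /lattice_points_cell[F sF xF].
rewrite (big_pred1 F) // => F'; apply/andP/eqP => [[/asboolP sF' xF']|->].
  by apply: (cell_disjoint sF' sF _ xF); move: xF'; rewrite inE; apply.
by split; [apply/asboolP|rewrite inE].
Qed.

Lemma lattice_points_sum : exists c : 'I_m -> {fraction {mpoly rat[N]}},
  forall n, (0 < n)%N ->
    \sum_(x \in lattice_points n) qmon x = \sum_i c i * vmon i ^+ n.
Proof.
have /boolp.choice[c cP] (F : {set 'I_m}) :
    exists c : 'I_m -> {fraction {mpoly rat[N]}}, standard_face F ->
    forall n, (0 < n)%N ->
    \sum_(x \in cell F finset.set0 n) qmon x = \sum_(i in F) c i * vmon i ^+ n.
  have [sF|nF] := pselect (standard_face F); last by exists (fun=> 0).
  by have [c cP] := cell_sum sF; exists c.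
exists (fun i => \sum_(F : {set 'I_m} | `[< standard_face F >] && (i \in F)) c F i).
move=> n n0; rewrite lattice_points_partition.
under eq_bigr => F /asboolP sF do rewrite (cP F sF n n0).
rewrite (exchange_big_dep predT) //=; apply: eq_bigr => i _.
by rewrite mulr_suml.
Qed.

End LatticePoints.

(** * Degree bounds for products and powers *)

Section MsizeBounds.
Variables (N : nat) (A : idomainType).
Implicit Types (p q : {mpoly A[N]}).

(** Here [b] bounds the degree of [q], one less than its [msize]; zero factors are covered. *)
Lemma msizeM_leD p q b : (msize q <= b.+1)%N -> (msize (p * q) <= msize p + b)%N.
Proof.
have [->|p0] := eqVneq p 0; first by rewrite mul0r msize0.
have [->|q0] := eqVneq q 0; first by rewrite mulr0 msize0.
by move=> qb; rewrite msizeM // -subn1 leq_subLR addnCA leq_add2l add1n.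
Qed.

Lemma msizeX_le p a k : (msize p <= a.+1)%N -> (msize (p ^+ k) <= (a * k).+1)%N.
Proof.
move=> pa; elim: k => [|k IH]; first by rewrite expr0 msize1.
by rewrite exprSr mulnSr -addSn (leq_trans (msizeM_leD _ pa)) // leq_add2r.
Qed.

Lemma msize_prodX_le (g : 'I_N -> {mpoly A[N]}) (e : 'X_{1..N}) a :
  (forall k, (msize (g k) <= a.+1)%N) ->
  (msize (\prod_k g k ^+ e k) <= (a * mdeg e).+1)%N.
Proof.
move=> ga; rewrite mdegE big_distrr /=.
elim/big_rec2: _ => [|k b p _ pb]; first by rewrite msize1.
by rewrite mulrC addnC -addSn (leq_trans (msizeM_leD _ (msizeX_le _ (ga k)))) // leq_add2r.
Qed.

End MsizeBounds.

(** * Common denominators in a field of fractions *)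

Lemma fraction_denom (A : idomainType) (x : {fraction A}) :
  exists d p : A, d != 0 /\ tofrac d * x = tofrac p.
Proof.
elim/quotW: x => r; exists \d_r, \n_r; split; first exact: denom_ratioP.
rewrite -[LHS]/(FracField.mul _ _); apply/eqP.
rewrite !piE /equivf /FracField.mulf.
by rewrite !numden_Ratio ?(oner_eq0, mul1r, mulr1, denom_ratioP).
Qed.

Lemma common_denom (A : idomainType) (s : seq {fraction A}) :
  exists2 d : A, d != 0 &
    forall x, x \in s -> exists p : A, tofrac d * x = tofrac p.
Proof.
elim: s => [|x s [d d0 dP]]; first by exists 1; rewrite ?oner_eq0.
have [e [p [e0 ep]]] := fraction_denom x.
exists (e * d); first by rewrite mulf_neq0.
move=> y; rewrite inE => /orP[/eqP ->|/dP[p' p'P]].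
  by exists (d * p); rewrite !tofracM mulrAC ep mulrC.
by exists (e * p'); rewrite !tofracM -mulrA p'P.
Qed.

(** * Polynomials in the q-integers and their degree in q *)

Section QIntegers.
Variable N : nat.
Local Notation K := {fraction {mpoly rat[N]}}.
Implicit Types (k : 'I_N) (L : {mpoly K[N]}).

Lemma qvar_neq1 k : 1 - qvar k != 0.
Proof.
rewrite /qvar -tofrac1 -tofracB tofrac_eq0 subr_eq0; apply/eqP.
by move=> /(congr1 (fun p => msize p)); rewrite msize1 msizeX mdeg1.
Qed.

Definition qint_mpoly n k : {mpoly rat[N]} := \sum_(j < n) 'X_k ^+ j.

Lemma qint_mpolyE n k : qint n%:Z (qvar k) = tofrac (qint_mpoly n k).
Proof.
rewrite /qint -exprnP -opprB subrX1 -mulNr opprB mulrC mulKf ?qvar_neq1 //.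
by rewrite rmorph_sum; apply: eq_bigr => j _; rewrite rmorphXn.
Qed.

(** The form [n.-1.+1] fits the hypothesis of [msize_prodX_le] and covers n = 0. *)
Lemma msize_qint_mpoly n k : (msize (qint_mpoly n k) <= n.-1.+1)%N.
Proof.
apply: leq_trans (msize_sum _ _ _) _; apply/bigmax_leqP => j _.
rewrite mpolyXn msizeX mdegMn mdeg1 mul1n ltnS.
by case: n j => [[]|n j] //; rewrite -ltnS.
Qed.

Lemma qint_meval_degree L M (s : nat -> {mpoly rat[N]}) : (0 < M)%N ->
  (forall n, (0 < n)%N ->
     L.@[fun k => qint n%:Z (qvar k)] = tofrac (s n)) ->
  (forall n, (n * M < msize (s n))%N) -> (M < msize L)%N.
Proof.
move=> M0 Ls sM; rewrite ltnNge; apply/negP => LM.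
(* A denominator common to the coefficients of [L], and thus independent of n. *)
have [d d0 dP] := common_denom [seq L@_e | e <- msupp L].
have /boolp.choice[p pP] (e : 'X_{1..N}) : exists p : {mpoly rat[N]},
    e \in msupp L -> tofrac d * L@_e = tofrac p.
  have [eL|eL] := boolP (e \in msupp L); last by exists 0.
  by have [p pP] := dP _ (map_f _ eL); exists p.
pose C := \max_(e <- msupp L) msize (p e).
(* For this n every term has size at most C + (n - 1)(M - 1) = C M, hence at most n M. *)
pose n := C.+1.
have dsE : d * s n = \sum_(e <- msupp L) p e * \prod_k qint_mpoly n k ^+ e k.
  apply/eqP; rewrite -tofrac_eq; apply/eqP.
  rewrite tofracM -Ls // mevalE mulr_sumr rmorph_sum /=.
  apply: eq_big_seq => e eL; rewrite mulrA pP // tofracM; congr *%R.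
  rewrite rmorph_prod; apply: eq_bigr => k _.
  by rewrite qint_mpolyE rmorphXn.
have s0 : s n != 0.
  by rewrite -msize_poly_eq0 -lt0n (leq_ltn_trans _ (sM n)).
(* Multiplying by the nonzero [d] does not lower the degree. *)
have : (n * M < msize (d * s n))%N.
  apply: leq_trans (sM n) _; rewrite msizeM //.
  by rewrite -[msize d]prednK ?lt0n ?msize_poly_eq0 // addSn leq_addl.
apply/negP; rewrite -leqNgt dsE.
apply: leq_trans (msize_sum _ _ _) _; apply/bigmax_leqP_seq => e eL _.
apply: leq_trans (msizeM_leD _ (msize_prodX_le e (msize_qint_mpoly n))) _.
have eM : (mdeg e <= M.-1)%N.
  by rewrite -ltnS prednK // (leq_trans (msize_mdeg_lt eL)).
have pC : (msize (p e) <= C)%N by rewrite /C (big_rem e) //= leq_maxl.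
apply: leq_trans (leq_add pC (leq_mul (leqnn _) eM)) _.
by rewrite /n /= -mulnS prednK // mulSn leq_addl.
Qed.

End QIntegers.

Lemma natr_bigmax (R : realDomainType) m (f : 'I_m -> nat) :
  (\max_i f i)%:R = \big[Order.max/0]_i (f i)%:R :> R.
Proof.
apply: (big_morph (fun n : nat => n%:R)) => // a b.
by rewrite -natr_max.
Qed.

(** * The polynomial in the q-integers and the degree of the lattice point sum *)

Section LatticePolynomial.
Variables (R : realType) (N m : nat) (u : 'I_m -> 'X_{1..N}).
Local Notation K := {fraction {mpoly rat[N]}}.

(** The variable ['X_k] stands for the q-integer in [qvar k], so the [k]-th base evaluates to
    [qvar k ^+ n]. *)
Definition exp_sum_mpoly (c : 'I_m -> K) : {mpoly K[N]} :=
  \sum_i c i *: \prod_k (1 - (1 - qvar k) *: 'X_k) ^+ u i k.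

Lemma meval_exp_sum_mpoly c n :
  (exp_sum_mpoly c).@[fun k => qint n%:Z (qvar k)] = \sum_i c i * vmon u i ^+ n.
Proof.
rewrite /exp_sum_mpoly raddf_sum; apply: eq_bigr => i _ /=.
rewrite mevalZ rmorph_prod /vmon /qmon -prodrXl; congr *%R.
apply: eq_bigr => k _; rewrite rmorphXn /= mevalB meval1 mevalZ mevalXU.
rewrite /qint mulrC divfK ?qvar_neq1 // subKr mxE -!exprnP.
by rewrite -!exprM mulnC.
Qed.

Lemma msize_exp_sum_mpoly c M : (forall i, (mdeg (u i) <= M)%N) ->
  (msize (exp_sum_mpoly c) <= M.+1)%N.
Proof.
move=> uM; apply: leq_trans (msize_sum _ _ _) _; apply/bigmax_leqP => i _.
apply: leq_trans (msizeZ_le _ _) _.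
(* The factor 1 is the degree bound of each affine base. *)
apply: (@leq_trans (1 * mdeg (u i)).+1); last by rewrite mul1n ltnS.
apply: msize_prodX_le => k; apply: leq_trans (msizeD_le _ _) _.
rewrite geq_max msize1 /= msizeN; apply: leq_trans (msizeZ_le _ _) _.
by rewrite msizeX mdeg1.
Qed.

(** Absolute values make this total; it inverts [nvec] on nonnegative vectors. *)
Definition abs_mnm (x : 'rV[int]_N) : 'X_{1..N} :=
  [multinom `|x ord0 k|%N | k < N].

Lemma abs_mnmK (x : 'rV[int]_N) : (forall k, 0 <= x ord0 k) ->
  nvec (abs_mnm x) = x.
Proof. by move=> x0; apply/rowP => k; rewrite mxE mnmE gez0_abs. Qed.

Lemma nvecK (e : 'X_{1..N}) : abs_mnm (nvec e) = e.
Proof. by apply/mnmP => k; rewrite mnmE mxE. Qed.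

(** The lattice point sum before passing to fractions, where its degree in q can be measured. *)
Definition lattice_mpoly n : {mpoly rat[N]} :=
  \sum_(x <- fset_set (lattice_points R u n)) 'X_[abs_mnm x].

Lemma lattice_mpolyE n :
  tofrac (lattice_mpoly n) = \sum_(x \in lattice_points R u n) qmon x.
Proof.
have fin := @finite_lattice_points R _ _ u n.
rewrite fsbig_finite //= rmorph_sum; apply: eq_big_seq => x /=.
rewrite in_fset_set // inE => xn; rewrite -qmon_nvec abs_mnmK // => k.
by have /andP[] := lattice_points_bound k xn.
Qed.

Lemma lattice_points_muln i n : lattice_points R u n (nvec (u i *+ n)).
Proof.
elim: n => [|n [l lx]].
  exists 0; split=> [k||]; first by rewrite mxE.
    by rewrite big1 // => k _; rewrite mxE.
  rewrite big1 => [|k _]; last by rewrite mxE scale0r.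
  by apply/rowP => k; rewrite !mxE mulmnE muln0.
exists (delta_mx ord0 i + l).
have -> : nvec (u i *+ n.+1) = nvec (u i) + nvec (u i *+ n).
  by apply/rowP => k; rewrite !mxE !mulmnE mulnS PoszD.
exact: combinesD (combines_delta R u i) lx.
Qed.

(** The coefficients count lattice points, so the monomial of the n-fold vertex cannot cancel. *)
Lemma msize_lattice_mpoly i n : (n * mdeg (u i) < msize (lattice_mpoly n))%N.
Proof.
have fin := @finite_lattice_points R _ _ u n.
rewrite mulnC -mdegMn; apply: msize_mdeg_lt; rewrite mcoeff_msupp.
rewrite /lattice_mpoly raddf_sum /=; under eq_bigr do rewrite mcoeffX.
rewrite -natr_sum pnatr_eq0 (big_rem (nvec (u i *+ n))) /=; last first.
  by rewrite in_fset_set // inE; apply: lattice_points_muln.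
by rewrite nvecK eqxx.
Qed.

End LatticePolynomial.

(** * Existence and exact degree of the polynomial of [P] *)

Theorem theorem2p3 (R : realType) (N d m : nat) (P : set 'rV[R]_N)
    (v : 'I_m -> 'rV[R]_N)
    (P_ge0 : forall x, P x -> forall k : 'I_N, 0 <= x ord0 k)
    (P_int : integral_polytope P)
    (P_dim : has_dim P d)
    (v_inj : injective v)
    (v_vert : forall x, vertex P x <-> exists i : 'I_m, x = v i) :
  exists L : {mpoly {fraction {mpoly rat[N]}}[N]},
    (forall n : nat, (0 < n)%N ->
       L.@[fun k : 'I_N => qint n%:Z (qvar k)] = sigma (dilate n P)) /\
    (tdegree L)%:R = \big[Order.max/0]_(i < m) \sum_(k < N) v i ord0 k.
Proof.
have [Ppol Pv] := P_int.
(* Vertices are integral and lie in the nonnegative orthant, hence are exponent vectors. *)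
have /boolp.choice[u uP] i : exists e : 'X_{1..N}, v i = int_point R (nvec e).
  have vi : vertex P (v i) by apply/v_vert; exists i.
  have [a aE] := Pv _ vi; exists (abs_mnm a).
  rewrite abs_mnmK // => k; rewrite -(ler_int R).
  by have := P_ge0 _ vi.1 k; rewrite aE mxE.
have uI : injective u by move=> i j uij; apply: v_inj; rewrite !uP uij.
have sigmaE n : (0 < n)%N ->
    sigma (dilate n P) = \sum_(x \in lattice_points R u n) qmon x.
  move=> n0; have nR : n%:R != 0 :> R by rewrite pnatr_eq0 -lt0n.
  apply: eq_fsbigl; apply/seteqP; split=> x /=.
    move=> [y /(polytope_vertexP _ Ppol v_inj v_vert)[l [l0 l1 yE]] xE].
    exists (n%:R *: l); split.
    - by move=> i; rewrite mxE mulr_ge0.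
    - by under eq_bigr do rewrite mxE; rewrite -mulr_sumr l1 mulr1.
    - rewrite -xE yE scaler_sumr; apply: eq_bigr => i _.
      by rewrite mxE scalerA uP.
  move=> [l [l0 l1 xE]]; exists (n%:R^-1 *: int_point R x); last first.
    by rewrite scalerA divff // scale1r.
  apply/(polytope_vertexP _ Ppol v_inj v_vert); exists (n%:R^-1 *: l); split.
  - by move=> i; rewrite mxE mulr_ge0 // invr_ge0.
  - by under eq_bigr do rewrite mxE; rewrite -mulr_sumr l1 mulVf.
  - rewrite xE scaler_sumr; apply: eq_bigr => i _.
    by rewrite mxE scalerA uP.
have [c cP] := lattice_points_sum R uI.
exists (exp_sum_mpoly u c).
have LE n : (0 < n)%N -> (exp_sum_mpoly u c).@[fun k : 'I_N => qint n%:Z (qvar k)] =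
    \sum_(x \in lattice_points R u n) qmon x.
  by move=> n0; rewrite meval_exp_sum_mpoly cP.
split=> [n n0|]; first by rewrite LE // sigmaE.
have vsum i : \sum_(k < N) v i ord0 k = (mdeg (u i))%:R.
  rewrite mdegE natr_sum; apply: eq_bigr => k _.
  by rewrite uP !mxE -pmulrn.
under eq_bigr do rewrite vsum.
rewrite -natr_bigmax; congr (_%:R); rewrite /tdegree.
set M := \max_i mdeg (u i).
have Lle : (msize (exp_sum_mpoly u c) <= M.+1)%N.
  by apply: msize_exp_sum_mpoly => i; apply: leq_bigmax.
(* For M = 0 the upper bound already forces degree 0; the lower bound argument needs M positive. *)
have [M0|M0] := posnP M.
  by move: Lle; rewrite M0; case: (msize _) => [|[]].
suff Lgt : (M < msize (exp_sum_mpoly u c))%N.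
  by apply/eqP; rewrite -eqSS prednK ?(leq_ltn_trans _ Lgt) // eqn_leq Lle.
(* A vertex attaining the maximum; positivity of M guarantees that there is a vertex. *)
have [|i Mi] := @bigop.eq_bigmax _ (fun i => mdeg (u i)).
  rewrite card_ord lt0n; apply: contraTneq M0 => m0.
  by rewrite /M big1 // => j; have := leq_trans (ltn_ord j) (eq_leq m0).
apply: (@qint_meval_degree _ _ _ (lattice_mpoly R u)) => // n.
  by move=> n0; rewrite LE // lattice_mpolyE.
by rewrite /M Mi; apply: msize_lattice_mpoly.
Qed.
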